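(* Let $G$ be a graph with $n$ nodes and $m$ edges, let $\mathcal{S}=a_1:\ldots:a_\ell$ be a hierarchy with integers $a_i\ge 2$, and let $1\le h\le\ell$. Solving the partitioning subproblems of the $h$ upper layers (layers $\ell,\ell-1,\ldots,\ell-h+1$) of the online recursive multi-section with Fennel and those of the remaining layers with Hashing has overall time complexity $O\big(mh + n\sum_{i=\ell-h+1}^{\ell}a_i\big)$.
   Context: One-pass streaming model: nodes of $G$ arrive one at a time together with their neighborhood $N(u)$ and must be permanently assigned to a block on arrival. A hierarchy $\mathcal{S}=a_1:\ldots:a_\ell$ defines a tree of blocks: layer $\ell$ has $a_\ell$ blocks; each block of layer $i>1$ has $a_{i-1}$ sub-blocks in layer $i-1$; layer $1$ contains the $k=\prod a_i$ final blocks. Online recursive multi-section: when node $u$ arrives, for $i=\ell,\ldots,1$ it chooses one of the $a_i$ candidate blocks of layer $i$ (all top-layer blocks if $i=\ell$, otherwise the sub-blocks of the block chosen at layer $i+1$) and assigns $u$ to it; weights of all blocks are maintained. Fennel chooses the candidate $W$ maximizing $|W\cap N(u)|-\alpha_i\gamma|W|^{\gamma-1}$ (constants $\alpha_i,\gamma$), which costs $O(|N(u)|+a_i)$ time per layer. Hashing assigns a node to a block via a hash function in $O(1)$ time; in the hybrid, the remaining lower layers are handled by a single Hashing operation per node. *)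

(* Defs.v *)
From HB Require Import structures.
From mathcomp Require Import all_boot all_order all_algebra.
From mathcomp Require Import reals exp.

Set Implicit Arguments.
Unset Strict Implicit.
Unset Printing Implicit Defensive.

(* Simple undirected graphs are symmetric irreflexive relations on a finType. *)
Definition edges (T : finType) (e : rel T) : {set {set T}} :=
  [set [set x; y] | x in T, y in T & e x y].

(* A one-pass stream: every node occurs once, in any order, together with a
   duplicate-free list, in any order, of its neighbours. *)
Definition node_stream (T : finType) (e : rel T) (s : seq (T * seq T)) : Prop :=
  perm_eq (unzip1 s) (enum T) /\
  forall u Nu, (u, Nu) \in s -> uniq Nu /\ Nu =i e u.

(* Elementary operations of the machine.  A cost model gives each of them an
   arbitrary constant cost.  [Score] is one evaluation of the Fennel objective,
   which, as usual in this setting, includes one real power. *)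
Inductive op := Receive | Load | Store | Arith | Score | Hash | Branch.
Definition cost_model := op -> nat.

(* Blocks of layer i are numbered so that the sub-blocks in layer i of the block
   p of layer i.+1 are p * a_i + c for c < a_i; the (virtual) root is block 0.
   Memory is zero-initialised: nobody is assigned, all weights are 0. *)
Record memory (T : Type) := Memory {
  blk : nat -> T -> option nat;   (* layer, node |-> block of the node *)
  wgt : nat -> nat -> nat;        (* layer, block |-> number of nodes in it *)
  cnt : nat -> nat                (* scratch array, indexed by candidates *)
}.
Definition memory0 (T : Type) : memory T :=
  Memory (fun _ _ => None) (fun _ _ => 0) (fun _ => 0).

(* Computations acting on the memory, returning a result and elapsed time. *)
Definition timed (T A : Type) := memory T -> memory T * A * nat.

Section Timed.
Variable T : eqType.

Definition ret (A : Type) (x : A) : timed T A := fun s => (s, x, 0).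
Definition bind (A B : Type) (m : timed T A) (f : A -> timed T B) : timed T B :=
  fun s => let: (s1, x, t1) := m s in
           let: (s2, y, t2) := f x s1 in (s2, y, t1 + t2).
Definition time (A : Type) (m : timed T A) : nat := (m (memory0 T)).2.

Variable w : cost_model.

Definition calc (o : op) (A : Type) (x : A) : timed T A := fun s => (s, x, w o).

Definition get_blk i v : timed T (option nat) := fun s => (s, blk s i v, w Load).
Definition get_wgt i b : timed T nat := fun s => (s, wgt s i b, w Load).
Definition get_cnt c : timed T nat := fun s => (s, cnt s c, w Load).

Definition set_blk i v b : timed T unit := fun s =>
  (Memory (fun i' v' => if (i' == i) && (v' == v) then Some b else blk s i' v')
     (wgt s) (cnt s), tt, w Store).
Definition set_wgt i b x : timed T unit := fun s =>
  (Memory (blk s)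
     (fun i' b' => if (i' == i) && (b' == b) then x else wgt s i' b')
     (cnt s), tt, w Store).
Definition set_cnt c x : timed T unit := fun s =>
  (Memory (blk s) (wgt s) (fun c' => if c' == c then x else cnt s c'),
   tt, w Store).

(* [loop r x body] runs [body] over [r], threading an accumulator from [x]; every
   test of the loop condition costs one [Branch]. *)
Fixpoint loop (I A : Type) (r : seq I) (x : A) (body : I -> A -> timed T A) :
    timed T A :=
  bind (calc Branch tt) (fun _ =>
  if r is i :: r' then bind (body i x) (fun y => loop r' y body) else ret x).

End Timed.

Notation "x <-- m ; f" := (bind m (fun x => f))
  (at level 100, m at level 90, f at level 200, right associativity).

(* Number of final blocks below a block of layer d.+1. *)
Definition final_below (a : nat -> nat) (d : nat) : nat :=
  \prod_(1 <= j < d.+1) a j.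

Section Algorithm.
Variables (R : realType) (T : finType) (w : cost_model).
(* [tie u b b'] decides whether, among candidates of equal score for u, the
   later b' supersedes b: an arbitrary tie-breaking rule. *)
Variables (a : nat -> nat) (alpha : nat -> R) (gamma : R)
          (tie : T -> nat -> nat -> bool).

Definition fennel_score (i inter weight : nat) : R :=
  (inter%:R - alpha i * gamma * (weight%:R `^ (gamma - 1)))%R.

Definition score_candidate i p c : timed T R :=
  b <-- calc w Arith (p * a i + c);
  k <-- get_cnt w c;
  x <-- get_wgt w i b;
  calc w Score (fennel_score i k x).

(* Fennel for u among the sub-blocks in layer i of block p: reset the a_i
   counters, let [cnt c] be the number of neighbours in candidate c, then scan
   the candidates for the best score. *)
Definition fennel i p u (Nu : seq T) : timed T nat :=
  _ <-- loop w (iota 0 (a i)) tt (fun c _ => set_cnt w c 0);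
  _ <-- loop w Nu tt (fun v _ =>
          ob <-- get_blk w i v;
          _ <-- calc w Branch tt;
          if ob is Some b then
            q <-- calc w Arith (b %/ a i);
            _ <-- calc w Branch tt;
            if q == p then
              c <-- calc w Arith (b %% a i);
              k <-- get_cnt w c;
              k' <-- calc w Arith k.+1;
              set_cnt w c k'
            else ret tt
          else ret tt);
  x0 <-- score_candidate i p 0;
  best <-- loop w (iota 1 (a i).-1) (0, x0) (fun c best =>
             x <-- score_candidate i p c;
             _ <-- calc w Branch tt;
             ret (if (best.2 < x)%R
                     || ((best.2 == x) && tie u (p * a i + best.1) (p * a i + c))
                  then (c, x) else best));
  calc w Arith (p * a i + best.1).

Definition assign i u b : timed T unit :=
  _ <-- set_blk w i u b;
  x <-- get_wgt w i b;
  x' <-- calc w Arith x.+1;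
  set_wgt w i b x'.

Variables (l h : nat) (hash : T -> 'I_(final_below a (l - h))).

(* Layers l, l - 1, ..., l - h + 1. *)
Definition upper_layers : seq nat := [seq l - j | j <- iota 0 h].

(* The hash value of u directly selects one of the final blocks below the block
   that Fennel chose for u in layer l - h + 1, in one operation whatever l - h is;
   so only the final block is recorded, and the blocks of the layers strictly
   between 1 and l - h + 1, which no decision reads, are implied by it. *)
Definition hashing u p : timed T unit :=
  r <-- calc w Hash (hash u : nat);
  b <-- calc w Arith (p * final_below a (l - h) + r);
  assign 1 u b.

Definition process_node u (Nu : seq T) : timed T unit :=
  _ <-- calc w Receive tt;
  _ <-- loop w Nu tt (fun v _ => calc w Receive tt);
  p <-- loop w upper_layers 0 (fun i p =>
          b <-- fennel i p u Nu;
          _ <-- assign i u b;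
          ret b);
  _ <-- calc w Branch tt;
  if h < l then hashing u p else ret tt.

Fixpoint hybrid_multisection (s : seq (T * seq T)) : timed T unit :=
  if s is (u, Nu) :: s' then
    _ <-- process_node u Nu; hybrid_multisection s'
  else ret tt.

End Algorithm.

(* Main.v *)
Require Import Defs.
From HB Require Import structures.
From mathcomp Require Import all_boot all_order all_algebra.
From mathcomp Require Import reals exp.
From mathcomp Require Import zify.

Set Implicit Arguments.
Unset Strict Implicit.
Unset Printing Implicit Defensive.

(** Let [W] bound the cost of every elementary operation.  In any memory state,
    Fennel in layer [i] on a node of degree [d] takes time at most
    [W * (8 + 8 * a i + 9 * d)].  Summing over the [h] upper layers, and absorbing
    the additive terms thanks to [h >= 1] and [a i >= 2], a node takes time at most
    [W * (20 * A + 11 * d * h)], where [A] is the sum of the [a i] over those layers.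
    Degrees sum to at most [2 * m], so [C := 22 * W] works. *)

(** Double counting: the degree sum counts ordered adjacent pairs, and sending [(x, y)] to
    [[set x; y]] maps them into the edges with fibres of at most two elements. *)
Lemma card_rel_le_edges (T : finType) (e : rel T) :
  \sum_(u : T) #|e u| <= 2 * #|edges e|.
Proof.
have -> : \sum_(u : T) #|e u| = \sum_(p : T * T | e p.1 p.2) 1.
  rewrite -(pair_big_dep xpredT e (fun _ _ => 1)) /=.
  by apply: eq_bigr => u _; rewrite sum1_card.
rewrite (partition_big (fun p : T * T => [set p.1; p.2]) (mem (edges e))) /=.
  rewrite mulnC -sum_nat_const; apply: leq_sum => E.
  case/imset2P => x y _ _ ->; rewrite sum1_card.
  apply: leq_trans (_ : #|[set (x, y); (y, x)]| <= 2); last first.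
    by rewrite cards2; case: eqP.
  apply: subset_leq_card; apply/subsetP => -[p q]; rewrite inE /=.
  case/andP => _ /eqP eqE; rewrite !inE !xpair_eqE.
  (* These four memberships determine [(p, q)] up to a swap. *)
  have: x \in [set p; q] by rewrite eqE set21.
  have: y \in [set p; q] by rewrite eqE set22.
  have: p \in [set x; y] by rewrite -eqE set21.
  have: q \in [set x; y] by rewrite -eqE set22.
  rewrite !inE (eq_sym x) (eq_sym y) (eq_sym x q) (eq_sym y q).
  by do 4!case: eqP => //=.
by move=> [x y] /= exy; apply/imset2P; exists x y; rewrite ?inE.
Qed.

(** Arrival order is irrelevant to a sum, and a duplicate-free neighbour list has the degree as its
    length. *)
Lemma node_stream_degree_sum (T : finType) (e : rel T) (s : seq (T * seq T)) :
  node_stream e s -> \sum_(x <- s) size x.2 = \sum_(u : T) #|e u|.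
Proof.
case=> perm_s nbhd_s; rewrite -[RHS]big_enum /= -(perm_big _ perm_s) big_map.
rewrite big_seq [RHS]big_seq; apply: eq_bigr => -[u Nu] /nbhd_s [uniqN eqN] /=.
by rewrite -(card_uniqP uniqN); apply: eq_card => v; rewrite eqN.
Qed.

Lemma node_stream_size (T : finType) (e : rel T) (s : seq (T * seq T)) :
  node_stream e s -> size s = #|T|.
Proof. by case=> /perm_size; rewrite size_map -cardE. Qed.

Lemma big_upper_layers (a : nat -> nat) (l h : nat) :
  h <= l ->
  \sum_(i <- upper_layers l h) a i = \sum_(l - h + 1 <= i < l.+1) a i.
Proof.
move=> le_hl; rewrite /upper_layers big_map -[X in iota 0 X]subn0.
(* [upper_layers] runs downwards from [l], so one range is reversed and the other shifted to start
   at 0. *)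
rewrite -/(index_iota 0 h) big_nat_rev /= -[l - h + 1]add0n big_addn add0n.
have -> : l.+1 - (l - h + 1) = h by lia.
by apply: eq_big_nat => j /andP[_ lt_jh]; congr (a _); lia.
Qed.

(** Uniformity in the memory state makes bounds compose under [bind], whose second part starts from
    whatever state the first one leaves. *)
Definition time_le (T A : Type) (m : timed T A) (t : nat) :=
  forall s, (m s).2 <= t.

Section TimeBounds.
Variables (T : eqType) (w : cost_model) (W : nat).
Hypothesis w_le : forall o, w o <= W.

Lemma time_le_weaken A (m : timed T A) t t' :
  time_le m t -> t <= t' -> time_le m t'.
Proof. by move=> mt le_tt' s; apply: leq_trans le_tt'. Qed.

Lemma time_le_bind A B (m : timed T A) (f : A -> timed T B) t1 t2 :
  time_le m t1 -> (forall x, time_le (f x) t2) -> time_le (bind m f) (t1 + t2).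
Proof.
move=> m_le f_le s; rewrite /bind; have := m_le s.
case: (m s) => [[s1 x] u1] /= le1; have := f_le x s1.
by case: (f x s1) => [[s2 y] u2] /= le2; apply: leq_add.
Qed.

Lemma time_le_ret A (x : A) t : time_le (ret x : timed T A) t.
Proof. by []. Qed.

(** The isolated [W] pays for the last, failing test of the loop condition. *)
Lemma time_le_loop (I A : Type) (r : seq I) (x : A) (body : I -> A -> timed T A)
    (g : I -> nat) :
  (forall i y, time_le (body i y) (g i)) ->
  time_le (loop w r x body) (W + \sum_(i <- r) (W + g i)).
Proof.
move=> body_le; elim: r x => [|i r IHr] x /=.
  rewrite big_nil; apply: time_le_bind => [|_]; first exact: (fun=> w_le _).
  exact: time_le_ret.
rewrite big_cons -addnA [W + (g i + _)]addnCA.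
apply: time_le_bind => [|_]; first exact: (fun=> w_le _).
by apply: time_le_bind.
Qed.

Lemma time_le_loop_const (I A : Type) (r : seq I) (x : A)
    (body : I -> A -> timed T A) (t : nat) :
  (forall i y, time_le (body i y) t) ->
  time_le (loop w r x body) (W + size r * (W + t)).
Proof.
move=> body_le; have := time_le_loop r x body_le.
by rewrite big_const_seq count_predT iter_addn_0 mulnC.
Qed.

End TimeBounds.

Section AlgorithmBounds.
Variables (R : realType) (T : finType) (w : cost_model) (W : nat).
Hypothesis w_le : forall o, w o <= W.
Variables (a : nat -> nat) (alpha : nat -> R) (gamma : R)
          (tie : T -> nat -> nat -> bool).

Lemma time_le_score_candidate i p c :
  time_le (score_candidate w a alpha gamma i p c : timed T R) (4 * W).
Proof.
have -> : 4 * W = W + (W + (W + W)) by lia.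
do 3!(apply: time_le_bind => [|?]; first exact: (fun=> w_le _)).
exact: (fun=> w_le _).
Qed.

Lemma time_le_fennel i p u (Nu : seq T) :
  time_le (fennel w a alpha gamma tie i p u Nu) (W * (8 + 8 * a i + 9 * size Nu)).
Proof.
(* The sum mirrors the program: counter reset, neighbour loop (a test and at most 8 operations per
   turn), first score, scan of the other candidates, final index. The weakening rounds [(a i).-1] up
   to [a i]. *)
apply: (@time_le_weaken _ _ _ ((W + size (iota 0 (a i)) * (W + W)) +
  ((W + size Nu * (W + (W + (W + (W + (W + (W + (W + (W + W))))))))) +
  (4 * W + ((W + size (iota 1 (a i).-1) * (W + (4 * W + (W + 0)))) + W)))));
  last by rewrite !size_iota; nia.
apply: time_le_bind => [|_].
  by apply: time_le_loop_const => // c _; exact: (fun=> w_le _).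
apply: time_le_bind => [|_].
  apply: time_le_loop_const => // v _.
  apply: time_le_bind => [|ob]; first exact: (fun=> w_le _).
  apply: time_le_bind => [|_]; first exact: (fun=> w_le _).
  case: ob => [b|]; last exact: time_le_ret.
  do 2!(apply: time_le_bind => [|?]; first exact: (fun=> w_le _)).
  case: ifP => _; last exact: time_le_ret.
  do 3!(apply: time_le_bind => [|?]; first exact: (fun=> w_le _)).
  exact: (fun=> w_le _).
apply: time_le_bind => [|x0]; first exact: time_le_score_candidate.
apply: time_le_bind => [|best]; last exact: (fun=> w_le _).
apply: time_le_loop_const => // c best.
apply: time_le_bind => [|x]; first exact: time_le_score_candidate.
by apply: time_le_bind => [|_]; [exact: (fun=> w_le _) | apply: time_le_ret].
Qed.

Lemma time_le_assign i (u : T) b : time_le (assign w i u b) (4 * W).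
Proof.
have -> : 4 * W = W + (W + (W + W)) by lia.
do 3!(apply: time_le_bind => [|?]; first exact: (fun=> w_le _)).
exact: (fun=> w_le _).
Qed.

Variables (l h : nat) (hash : T -> 'I_(final_below a (l - h))).

(** One hash selects the final block directly, hence a bound independent of the number [l - h] of
    remaining layers. *)
Lemma time_le_hashing u p : time_le (hashing w hash u p) (6 * W).
Proof.
have -> : 6 * W = W + (W + 4 * W) by lia.
do 2!(apply: time_le_bind => [|?]; first exact: (fun=> w_le _)).
exact: time_le_assign.
Qed.

Hypothesis h_gt0 : 0 < h.
Let A := \sum_(i <- upper_layers l h) a i.
Hypothesis A_ge : 2 * h <= A.

Lemma time_le_process_node u (Nu : seq T) :
  time_le (process_node w alpha gamma tie hash u Nu)
    (W * (20 * A + 11 * h * size Nu)).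
Proof.
pose layer i := W * (8 + 8 * a i + 9 * size Nu) + (4 * W + 0).
have layersE : \sum_(i <- upper_layers l h) (W + layer i) =
    W * (13 * h + 8 * A + 9 * h * size Nu).
  transitivity (\sum_(i <- upper_layers l h)
                   (W * 8 * a i + W * (13 + 9 * size Nu))).
    by apply: eq_bigr => i _; rewrite /layer; lia.
  rewrite big_split /= -big_distrr /= -/A big_const_seq count_predT iter_addn_0.
  by rewrite !size_map size_iota; lia.
apply: (@time_le_weaken _ _ _ (W + ((W + size Nu * (W + W)) +
  ((W + \sum_(i <- upper_layers l h) (W + layer i)) + (W + 6 * W))))); last first.
  rewrite layersE.
  have -> : W + (W + size Nu * (W + W) +
      (W + W * (13 * h + 8 * A + 9 * h * size Nu) + (W + 6 * W))) =
      W * (10 + 2 * size Nu + 13 * h + 8 * A + 9 * (h * size Nu)) by lia.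
  rewrite leq_mul2l; apply/orP; right.
  (* Absorption: [10 + 13 * h <= 24 * h <= 12 * A] by [h_gt0] and [A_ge], and [2 * size Nu] goes
     into [2 * h * size Nu]. *)
  have : size Nu <= h * size Nu by rewrite leq_pmull.
  by rewrite -mulnA; lia.
apply: time_le_bind => [|_]; first exact: (fun=> w_le _).
apply: time_le_bind => [|_].
  by apply: time_le_loop_const => // v _; exact: (fun=> w_le _).
apply: time_le_bind => [|p].
  apply: time_le_loop => // i p.
  apply: time_le_bind => [|b]; first exact: time_le_fennel.
  by apply: time_le_bind => [|_]; [apply: time_le_assign | apply: time_le_ret].
apply: time_le_bind => [|_]; first exact: (fun=> w_le _).
by case: ifP => _; [apply: time_le_hashing | apply: time_le_ret].
Qed.

Lemma time_le_hybrid_multisection (s : seq (T * seq T)) :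
  time_le (hybrid_multisection w alpha gamma tie hash s)
    (W * (20 * A * size s + 11 * h * \sum_(x <- s) size x.2)).
Proof.
elim: s => [|[u Nu] s IHs]; first exact: time_le_ret.
rewrite big_cons /= mulnS (mulnDr (11 * h)) addnACA mulnDr.
by apply: time_le_bind => [|_]; first exact: time_le_process_node.
Qed.

End AlgorithmBounds.

Theorem theorem3 (w : cost_model) :
  exists C : nat,
  forall (T : finType) (e : rel T) (s : seq (T * seq T))
    (l h : nat) (a : nat -> nat)
    (R : realType) (alpha : nat -> R) (gamma : R)
    (tie : T -> nat -> nat -> bool)
    (hash : T -> 'I_(final_below a (l - h))),
  symmetric e -> irreflexive e -> node_stream e s ->
  (forall i, 1 <= i <= l -> 2 <= a i) ->
  1 <= h <= l ->
  time (hybrid_multisection w alpha gamma tie hash s) <=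
    C * (#|edges e| * h + #|T| * \sum_(l - h + 1 <= i < l.+1) a i).
Proof.
pose W := w Receive + w Load + w Store + w Arith + w Score + w Hash + w Branch.
have w_le o : w o <= W by rewrite /W; case: o; lia.
(* The 22 is the factor 11 of the degree term times the 2 of the degree sum; it also covers the 20
   of the [A] term. [W] depends on [w] alone, so it may be chosen before the graph. *)
exists (22 * W) => T e s l h a R alpha gamma tie hash _ _ stream_s a_ge2.
case/andP=> h_gt0 le_hl.
have sumE := big_upper_layers a le_hl.
have A_ge : 2 * h <= \sum_(i <- upper_layers l h) a i.
  have -> : 2 * h = \sum_(l - h + 1 <= i < l.+1) 2.
    by rewrite sum_nat_const_nat mulnC; congr (_ * _); lia.
  rewrite sumE big_nat [X in _ <= X]big_nat.
  by apply: leq_sum => i /andP[lo hi]; apply: a_ge2; lia.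
apply: leq_trans (time_le_hybrid_multisection w_le alpha gamma tie hash h_gt0
  A_ge s (memory0 T)) _.
rewrite sumE (node_stream_size stream_s) (node_stream_degree_sum stream_s).
have := card_rel_le_edges e.
set d := \sum_u _; set A := \sum_(_ <= _ < _) _ => d_le.
rewrite (mulnC 22) -(mulnA W 22) leq_mul2l; apply/orP; right.
have : h * d <= h * (2 * #|edges e|) by rewrite leq_mul2l d_le orbT.
lia.
Qed.
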